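(* Let $\Phi:X\to X$ be a radius one sand automaton with local rule $\phi$, and put $\alpha=\phi(-\infty,-\infty)$, $\beta=\phi(-\infty,\infty)$, $\delta=\phi(\infty,-\infty)$, $\lambda=\phi(\infty,\infty)$. Then $\Phi$ is peak preserving if and only if $\alpha\ge\beta$, $\alpha\ge\delta$ and $\alpha\ge\lambda$; and $\Phi$ is valley preserving if and only if $\lambda\le\beta$, $\lambda\le\delta$ and $\lambda\le\alpha$.
   Context: Let $\widetilde{\mathbb{Z}}=\mathbb{Z}\cup\{-\infty,+\infty\}$ and $X=\widetilde{\mathbb{Z}}^{\mathbb{Z}}$. For $m\in\mathbb{Z}$, $n\in\widetilde{\mathbb{Z}}$ let $\beta_1^m(n)=+\infty$ if $n>m+1$, $-\infty$ if $n<m-1$, and $n-m$ otherwise, so $\beta_1^m(n)\in\widetilde{\mathcal{A}}_1=\{-\infty,-1,0,1,\infty\}$. A radius one sand automaton with local rule $\phi:\widetilde{\mathcal{A}}_1^{2}\to\{-2,-1,0,1,2\}$ is the map $\Phi:X\to X$ with $\Phi(\mathbf{x})_i=x_i$ if $x_i=\pm\infty$ and $\Phi(\mathbf{x})_i=x_i+\phi(\beta_1^{x_i}(x_{i-1}),\beta_1^{x_i}(x_{i+1}))$ if $x_i\in\mathbb{Z}$. (The first argument of $\phi$ is the left gradient, the second the right gradient.) Let $\mathcal{G}=\{\mathbf{x}\in\mathbb{Z}^{\mathbb{Z}}:|x_i-x_{i-1}|\ge2\text{ for all }i\in\mathbb{Z}\}$. A triple $(a,b,c)\in\mathbb{Z}^3$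 is a peak (centred at $b$) if $a\le b-2$ and $c\le b-2$, and a valley (centred at $b$) if $a\ge b+2$ and $c\ge b+2$. $\Phi$ is peak preserving (respectively valley preserving) if for every $\mathbf{x}\in\mathcal{G}$ and every $n\in\mathbb{Z}$ such that $(x_{n-1},x_n,x_{n+1})$ is a peak (respectively a valley), the triple $(\Phi(\mathbf{x})_{n-1},\Phi(\mathbf{x})_n,\Phi(\mathbf{x})_{n+1})$ is also a peak (respectively a valley). *)

(* Defs.v *)
From mathcomp Require Import all_boot all_order all_algebra.
From mathcomp Require Import constructive_ereal.

Set Implicit Arguments.
Unset Strict Implicit.
Unset Printing Implicit Defensive.

Import Order.TTheory GRing.Theory Num.Theory.

Local Open Scope ring_scope.
Local Open Scope ereal_scope.

Definition config := int -> \bar int.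

Definition symint (r : nat) := {z : int | (`|z| <= r%:Z)%R}.

Definition symint_val (r : nat) (z : symint r) : int := val z.

Coercion symint_val : symint >-> int.

Definition symint0 (r : nat) : symint r := exist _ (0 : int)%R isT.

(* In the last case [n] is finite and [fine n - m] is -1, 0 or 1, so the   *)
(* default value [symint0 1] of [insubd] is never used there.           *)
Definition gradient (m : int) (n : \bar int) : \bar (symint 1) :=
  if (m + 1)%R%:E < n then +oo
  else if n < (m - 1)%R%:E then -oo
  else (insubd (symint0 1) (fine n - m)%R)%:E.

Definition local_rule := \bar (symint 1) -> \bar (symint 1) -> symint 2.

(* The first argument of the local rule is the left gradient. *)
Definition sand_automaton (phi : local_rule) (x : config) : config := fun i =>
  if x i is m%:E then
    (m + phi (gradient m (x (i - 1)%R)) (gradient m (x (i + 1)%R)))%R%:E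
  else x i.

Definition all_cliffs (x : config) : Prop :=
  exists2 y : int -> int, x = (fun i => (y i)%:E) &
    forall i : int, (2 <= `|y i - y (i - 1)|)%R.

Definition peak (a b c : \bar int) : Prop :=
  match a, b, c with
  | a'%:E, b'%:E, c'%:E => (a' <= b' - 2)%R /\ (c' <= b' - 2)%R
  | _, _, _ => False
  end.

Definition valley (a b c : \bar int) : Prop :=
  match a, b, c with
  | a'%:E, b'%:E, c'%:E => (b' + 2 <= a')%R /\ (b' + 2 <= c')%R
  | _, _, _ => False
  end.

Definition peak_preserving (F : config -> config) : Prop :=
  forall (x : config), all_cliffs x ->
  forall n : int, peak (x (n - 1)%R) (x n) (x (n + 1)%R) ->
    peak (F x (n - 1)%R) (F x n) (F x (n + 1)%R).

Definition valley_preserving (F : config -> config) : Prop :=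
  forall (x : config), all_cliffs x ->
  forall n : int, valley (x (n - 1)%R) (x n) (x (n + 1)%R) ->
    valley (F x (n - 1)%R) (F x n) (F x (n + 1)%R).

(* Main.v *)
Require Import Defs.
From mathcomp Require Import all_boot all_order all_algebra.
From mathcomp Require Import constructive_ereal.
From mathcomp Require Import zify.

Import Order.TTheory GRing.Theory Num.Theory.

Local Open Scope ring_scope.

(** When neighbouring heights differ by at least two, every gradient is
    infinite, so the automaton adds to each site one of only four increments,
    according to which of its two neighbours are higher.  The top of a peak
    has two lower neighbours and moves by [alpha]; its left neighbour has a
    higher right neighbour and moves by [beta] or [lambda]; its right
    neighbour has a higher left neighbour and moves by [delta] or [lambda].
    The three inequalities on [alpha] say exactly that neither gap of the peak
    shrinks, whichever alternatives occur.  They are necessary because a gap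
    may be exactly two, where any shrinking destroys the peak: a pyramid with
    steps of height two realizes the increments [beta] and [delta] beside its
    summit, and a zigzag of amplitude two realizes [lambda] on both sides.
    Valleys are treated in the same way, with the pyramid turned upside down;
    the zigzag serves again, centred at one of its low sites. *)

Definition infinite_gradient (m n : int) : \bar (symint 1) :=
  if m < n then +oo%E else -oo%E.

Lemma gradient_cliff (m n : int) : 2 <= `|n - m| ->
  gradient m n%:E = infinite_gradient m n.
Proof.
move=> hmn; rewrite /gradient /infinite_gradient !lte_fin.
case: (ltP m n) => hlt; first by rewrite ifT //; lia.
by rewrite ifF ?ifT //; lia.
Qed.

(** Reduces the automaton to integer arithmetic with the four increments of
    the local rule at infinite gradients. *)
Lemma sand_automaton_cliffs (phi : local_rule) (y : int -> int) (i : int) :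
  (forall j, 2 <= `|y j - y (j - 1)|) ->
  sand_automaton phi (fun j => (y j)%:E%E) i =
  (y i + phi (infinite_gradient (y i) (y (i - 1)))
             (infinite_gradient (y i) (y (i + 1))))%:E%E.
Proof.
move=> hy; rewrite /sand_automaton !gradient_cliff //.
- by have := hy (i + 1); rewrite addrK.
- by have := hy i; rewrite distrC.
Qed.

(** For negative [c] the summit at [0] is a peak, for positive [c] it is a
    valley. *)
Definition pyramid (c i : int) : int := c * `|i|.

Definition zigzag (i : int) : int := if odd `|i|%N then -2 else 0.

Lemma pyramid_cliffs (c i : int) : 2 <= `|c| ->
  2 <= `|pyramid c i - pyramid c (i - 1)|.
Proof.
move=> hc; rewrite /pyramid -mulrBr normrM.
have -> : `| `|i| - `|i - 1| | = 1 :> int by lia.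
by rewrite mulr1.
Qed.

Lemma zigzag_cliffs (i : int) : 2 <= `|zigzag i - zigzag (i - 1)|.
Proof.
rewrite /zigzag; have -> : odd `|i - 1|%N = ~~ odd `|i|%N by lia.
by case: (odd _).
Qed.

Lemma peak_preservingP (phi : local_rule) :
  let alpha : int := phi -oo%E -oo%E in
  peak_preserving (sand_automaton phi) <->
  [/\ (phi -oo%E +oo%E : int) <= alpha, (phi +oo%E -oo%E : int) <= alpha
    & (phi +oo%E +oo%E : int) <= alpha].
Proof.
move=> alpha; split=> [hF | [hbeta hdelta hlambda]].
  (* Slope exactly two, so that each gap at the summit is the smallest a peak
     allows and any shrinking is detected. *)
  have hpyr i := @pyramid_cliffs (-2) i isT.
  have := hF _ (ex_intro2 _ _ _ erefl hpyr) 0 (conj isT isT).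
  have := hF _ (ex_intro2 _ _ _ erefl zigzag_cliffs) 0 (conj isT isT).
  rewrite !(sand_automaton_cliffs _ _ _ hpyr).
  rewrite !(sand_automaton_cliffs _ _ _ zigzag_cliffs).
  rewrite /= /infinite_gradient /pyramid /zigzag /= -/alpha.
  by move=> [? ?] [? ?]; split; lia.
move=> _ [y -> hy] n [hl hr].
rewrite !sand_automaton_cliffs //= subrK addrK /infinite_gradient.
have -> : (y n < y (n - 1)) = false by lia.
have -> : (y n < y (n + 1)) = false by lia.
have -> : y (n - 1) < y n by lia.
have -> : y (n + 1) < y n by lia.
by rewrite -/alpha; split; case: ifP => _; lia.
Qed.

Lemma valley_preservingP (phi : local_rule) :
  let lambda : int := phi +oo%E +oo%E in
  valley_preserving (sand_automaton phi) <->
  [/\ lambda <= (phi -oo%E +oo%E : int), lambda <= (phi +oo%E -oo%E : int)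
    & lambda <= (phi -oo%E -oo%E : int)].
Proof.
move=> lambda; split=> [hF | [hbeta hdelta halpha]].
  have hpyr i := @pyramid_cliffs 2 i isT.
  have := hF _ (ex_intro2 _ _ _ erefl hpyr) 0 (conj isT isT).
  (* The low sites of the zigzag are the odd ones. *)
  have := hF _ (ex_intro2 _ _ _ erefl zigzag_cliffs) 1 (conj isT isT).
  rewrite !(sand_automaton_cliffs _ _ _ hpyr).
  rewrite !(sand_automaton_cliffs _ _ _ zigzag_cliffs).
  rewrite /= /infinite_gradient /pyramid /zigzag /= -/lambda.
  by move=> [? ?] [? ?]; split; lia.
move=> _ [y -> hy] n [hl hr].
rewrite !sand_automaton_cliffs //= subrK addrK /infinite_gradient.
have -> : y n < y (n - 1) by lia.
have -> : y n < y (n + 1) by lia.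
have -> : (y (n - 1) < y n) = false by lia.
have -> : (y (n + 1) < y n) = false by lia.
by rewrite -/lambda; split; case: ifP => _; lia.
Qed.

Theorem theorem3p7 (phi : local_rule) :
  let alpha : int := phi -oo%E -oo%E in
  let beta : int := phi -oo%E +oo%E in
  let delta : int := phi +oo%E -oo%E in
  let lambda : int := phi +oo%E +oo%E in
  (peak_preserving (sand_automaton phi) <->
     [/\ beta <= alpha, delta <= alpha & lambda <= alpha]) /\
  (valley_preserving (sand_automaton phi) <->
     [/\ lambda <= beta, lambda <= delta & lambda <= alpha]).
Proof.
by move=> alpha beta delta lambda; split;
  [exact: peak_preservingP | exact: valley_preservingP].
Qed.
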